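(* If $S$ is a left cancellative semigroup, then the semigroup $(S,\Lambda;\circ_P)$ is also left cancellative for any non-empty set $\Lambda$ and any mapping $P:\Lambda\to S$.
   Context: For a semigroup $S$, a non-empty set $\Lambda$ and a mapping $P:\Lambda\to S$, $(S,\Lambda;\circ_P)$ denotes the semigroup with underlying set $S\times\Lambda$ and operation $(s,\lambda)\circ_P(t,\mu)=(s\,P(\lambda)\,t,\ \mu)$. A semigroup $T$ is left cancellative if $xa=xb$ implies $a=b$ for all $x,a,b\in T$. *)

(* Defs.v *)
From HB Require Import structures.
From mathcomp Require Import all_boot.

Set Implicit Arguments.
Unset Strict Implicit.
Unset Printing Implicit Defensive.

Local Open Scope group_scope.

(* MathComp's semigroupType requires its carrier to be a choiceType; this
   structure puts the same associativity axiom on a magma with any carrier. *)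
HB.mixin Record Magma_isAssociative G of Magma G := {
  assoc_mul : associative (@mul G)
}.

#[short(type="semigroup")]
HB.structure Definition PlainSemigroup :=
  {G of Magma_isAssociative G & Magma G}.

Definition left_cancellative (T : semigroup) : Prop :=
  forall x a b : T, x * a = x * b -> a = b.

(* The carrier of (S, L; o_P): a copy of S * L depending on P, since MathComp
   already gives S * L the componentwise multiplication. *)
Definition sandwich (S : semigroup) (L : Type) (P : L -> S) : Type :=
  (S * L)%type.

Section Sandwich.
Variables (S : semigroup) (L : Type) (P : L -> S).

Definition sandwich_mul (x y : sandwich P) : sandwich P :=
  (x.1 * P x.2 * y.1, y.2).

Lemma sandwich_mulA : associative sandwich_mul.
Proof. by move=> x y z; rewrite /sandwich_mul /= !assoc_mul. Qed.

HB.instance Definition _ := hasMul.Build (sandwich P) sandwich_mul.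
HB.instance Definition _ :=
  Magma_isAssociative.Build (sandwich P) sandwich_mulA.

End Sandwich.

(* Main.v *)
Require Import Defs.
From HB Require Import structures.
From mathcomp Require Import all_boot.

Theorem lemma4 (S : semigroup) (hS : left_cancellative S)
  (Lambda : Type) (hLambda : inhabited Lambda) (P : Lambda -> S) :
  left_cancellative (sandwich P).
Proof.
  (* The first component of a left multiple of (a, i) by (s, l) is
     (s * P l) * a, so a single cancellation of s * P l in S recovers a. *)
  by move=> [s l] [a i] [b j] [/hS -> ->].
Qed.
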